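(* Let $0\le\mu<L<\infty$ and $0<c_1<c_2<1$. Let $f:\mathbb R^n\to\mathbb R$ be a $(\mu,L)$-smooth function with global minimizer $\mathbf x_*$ and let $\{\mathbf x_k\}_{k\ge1}$ be any sequence of iterates generated using (noiseless) gradient descent with an inexact line search satisfying the Wolfe conditions with parameters $c_1,c_2$. Then for every $k\ge1$ the bound $$f_{k+1}-f_*\le\left(1-\frac{2\mu c_1(1-c_2)}{L}\right)(f_k-f_* )$$ holds and admits an SOS certificate of degree 1 with respect to the valid constraints $h_1(\mathbf z)\ge0,\dots,h_7(\mathbf z)\ge0$ defined in the context.
   Context: Notation: $f_i=f(\mathbf x_i)$ and $\mathbf g_i=\nabla f(\mathbf x_i)$ for $i\in\{k,k+1,*\}$; $\|\cdot\|$ is the Euclidean norm. Since $\mathbf x_*$ is a global minimizer, $\mathbf g_*=0$. $(\mu,L)$-smooth function: a convex differentiable $f:\mathbb R^n\to\mathbb R$ with $\|\nabla f(\mathbf x)-\nabla f(\mathbf y)\|\le L\|\mathbf x-\mathbf y\|$ for all $\mathbf x,\mathbf y$ ($L$-smooth) and $f(\mathbf x)-\frac\mu2\|\mathbf x\|^2$ convex ($\mu$-strongly convex). Gradient descent with the Wolfe conditions: $\mathbf x_{k+1}=\mathbf x_k-\gamma_k\mathbf g_k$ with step size $\gamma_k>0$ satisfying $$f(\mathbf x_k-\gamma_k\mathbf g_k)\le f(\mathbf x_k)-c_1\gamma_k\|\mathbf g_k\|^2,\qquad \mathbf g_{k+1}^\top\mathbf g_k\le c_2\|\mathbf g_k\|^2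 .$$ Constraint polynomials: let $\mathbf z=(f_*,f_k,f_{k+1},\mathbf x_*,\mathbf x_k,\mathbf x_{k+1},\mathbf g_*,\mathbf g_k,\mathbf g_{k+1})$, regarded as formal variables with $\mathbf g_*=0$ substituted. For $(i,j)$ put $$h_{(i,j)}(\mathbf z)=f_i-f_j-\mathbf g_j^\top(\mathbf x_i-\mathbf x_j)-\frac{L}{2(L-\mu)}\left(\frac1L\|\mathbf g_i-\mathbf g_j\|^2+\mu\|\mathbf x_i-\mathbf x_j\|^2-2\frac\mu L(\mathbf g_j-\mathbf g_i)^\top(\mathbf x_j-\mathbf x_i)\right).$$ Then $h_1,\dots,h_6$ are $h_{(i,j)}$ for $(i,j)=(k,k+1),(k,* ),(k+1,k),(k+1,* ),( *,k),( *,k+1)$ respectively; the inequalities $h_1,\dots,h_6\ge0$ are the interpolability conditions satisfied by every $(\mu,L)$-smooth function. The seventh is $$h_7(\mathbf z)=f_k-f_{k+1}-\frac{c_1(1-c_2)}{L}\|\mathbf g_k\|^2,$$ and the inequality $h_7\ge0$ is satisfied by the iterates of the method. The bound $f_{k+1}-f_*\le t(f_k-f_* )$ admits an SOS certificate of degree 1 if there are scalars $\sigma_1,\dots,\sigma_7\ge0$ and a polynomial $\sigma_0(\mathbf z)$ that is a sum of squares of polynomials of degree at most 1 such that, as an identity of polynomials in $\mathbf z$ (with $\mathbf g_*=0$), $$t(f_k-f_* )-(f_{k+1}-f_* )=\sigma_0(\mathbf z)+\sum_{i=1}^7\sigma_ih_i(\mathbf z).$$ *)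

(* Defs.v *)
From HB Require Import structures.
From mathcomp Require Import all_boot all_order all_algebra.
From mathcomp Require Import all_classical all_reals all_analysis.
From mathcomp Require mpoly.
(* The notations of mpoly clash with those of MathComp-Analysis. *)
Import -(notations) mpoly.

Set Implicit Arguments.
Unset Strict Implicit.
Unset Printing Implicit Defensive.

Import Order.TTheory GRing.Theory Num.Theory.
Import numFieldNormedType.Exports.

Local Open Scope ring_scope.

Definition dot (A : comNzRingType) (n : nat) (u v : 'rV[A]_n) : A :=
  (u *m v^T) 0 0.

(* The library's norm on 'rV[R]_n is the sup norm, hence this definition. *)
Definition enorm (R : realType) (n : nat) (u : 'rV[R]_n) : R :=
  Num.sqrt (dot u u).

Definition grad (R : realType) (n : nat) (f : 'rV[R]_n -> R) (x : 'rV[R]_n) :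
  'rV[R]_n := \row_i 'D_(delta_mx 0 i) f x.

Definition convex_on_space (R : realType) (n : nat) (f : 'rV[R]_n -> R) : Prop :=
  convex_function [set: convex_lmodType 'rV[R]_n]%classic f.

Definition mu_L_smooth (R : realType) (n : nat) (mu L : R)
    (f : 'rV[R]_n -> R) : Prop :=
  [/\ convex_on_space f,
      forall x, differentiable f x,
      forall x y, enorm (grad f x - grad f y) <= L * enorm (x - y) &
      convex_on_space (fun x => f x - mu / 2%:R * enorm x ^+ 2)].

(* The iterates are numbered from 1; x 0 and gamma 0 are unconstrained. *)
Definition gd_wolfe (R : realType) (n : nat) (c1 c2 : R) (f : 'rV[R]_n -> R)
    (x : nat -> 'rV[R]_n) (gamma : nat -> R) : Prop :=
  forall k, (1 <= k)%N ->
    [/\ 0 < gamma k,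
        x k.+1 = x k - gamma k *: grad f (x k),
        f (x k - gamma k *: grad f (x k))
          <= f (x k) - c1 * gamma k * enorm (grad f (x k)) ^+ 2 &
        dot (grad f (x k.+1)) (grad f (x k))
          <= c2 * enorm (grad f (x k)) ^+ 2].

Section SOS.
Variables (R : realType) (N : nat).
Implicit Types p : mpoly N R.

(* mpoly.msize p is 1 + the degree of p (and 0 for p = 0). *)
Definition is_sos (d : nat) p : Prop :=
  exists s : seq (mpoly N R),
    all (fun q => mpoly.msize q <= d.+1)%N s /\ p = \sum_(q <- s) q ^+ 2.

Definition sos_certificate (d m : nat) (h : m.-tuple (mpoly N R)) p :
    Prop :=
  exists (sigma0 : mpoly N R) (sigma : 'I_m -> R),
    [/\ is_sos d sigma0, forall i, 0 <= sigma i &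
        p = sigma0 + \sum_(i < m) sigma i *: tnth h i].

End SOS.

(* The indices *, k and k+1. *)
Variant pt := Star | Cur | Next.

(* The 3 + 5 * n formal variables are f_*, f_k, f_(k+1), followed by the
   coordinates of x_*, x_k, x_(k+1), g_k, g_(k+1) in this order; there are no
   variables for g_*, which is replaced by 0. *)
Section Variables.
Variables (R : realType) (n : nat).

Definition zpoly := mpoly (3 + 5 * n) R.

Definition scalar_var (i : 'I_3) : zpoly :=
  mpolyX R (mnm1 (lshift (5 * n) i)).

Definition vector_var (b : 'I_5) : 'rV[zpoly]_n :=
  \row_j mpolyX R (mnm1 (rshift 3 (mxvec_index b j))).

Definition fvar (i : pt) : zpoly :=
  match i with
  | Star => scalar_var (@Ordinal 3 0 isT)
  | Cur => scalar_var (@Ordinal 3 1 isT)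
  | Next => scalar_var (@Ordinal 3 2 isT)
  end.

Definition xvar (i : pt) : 'rV[zpoly]_n :=
  match i with
  | Star => vector_var (@Ordinal 5 0 isT)
  | Cur => vector_var (@Ordinal 5 1 isT)
  | Next => vector_var (@Ordinal 5 2 isT)
  end.

Definition gvar (i : pt) : 'rV[zpoly]_n :=
  match i with
  | Star => 0
  | Cur => vector_var (@Ordinal 5 3 isT)
  | Next => vector_var (@Ordinal 5 4 isT)
  end.

Definition zpoint (fs fk fk1 : R) (xs xk xk1 gk gk1 : 'rV[R]_n) :
    'I_(3 + 5 * n) -> R :=
  row_mx (\row_(i < 3) [:: fs; fk; fk1]`_i)
         (mxvec (\matrix_(b < 5) [:: xs; xk; xk1; gk; gk1]`_b)) 0.

Definition h_interp (mu L : R) (i j : pt) : zpoly :=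
  fvar i - fvar j - dot (gvar j) (xvar i - xvar j)
  - (L / (2%:R * (L - mu))) *:
      (L^-1 *: dot (gvar i - gvar j) (gvar i - gvar j)
       + mu *: dot (xvar i - xvar j) (xvar i - xvar j)
       - (2%:R * (mu / L)) *: dot (gvar j - gvar i) (xvar j - xvar i)).

Definition h_wolfe (L c1 c2 : R) : zpoly :=
  fvar Cur - fvar Next - (c1 * (1 - c2) / L) *: dot (gvar Cur) (gvar Cur).

Definition constraints (mu L c1 c2 : R) : 7.-tuple zpoly :=
  [tuple h_interp mu L Cur Next; h_interp mu L Cur Star;
         h_interp mu L Next Cur; h_interp mu L Next Star;
         h_interp mu L Star Cur; h_interp mu L Star Next;
         h_wolfe L c1 c2].

Definition bound_poly (t : R) : zpoly :=
  t *: (fvar Cur - fvar Star) - (fvar Next - fvar Star).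

End Variables.

(* Main.v *)
Require Import Defs.
From HB Require Import structures.
From mathcomp Require Import all_boot all_order all_algebra.
From mathcomp Require Import all_classical all_reals all_analysis.
From mathcomp Require mpoly.
From mathcomp Require Import ring lra.
Import -(notations) mpoly.

Set Implicit Arguments.
Unset Strict Implicit.
Unset Printing Implicit Defensive.

Import Order.TTheory GRing.Theory Num.Theory.
Import numFieldNormedType.Exports.

Local Open Scope ring_scope.

(** Put a = c1 (1 - c2) / L, so that t = 1 - 2 mu a and the polynomial to be
    certified is (f_k - f_(k+1)) - 2 mu a (f_k - f_* ).  The Wolfe constraint
    says that f_k - f_(k+1) is at least a |g_k|^2, and what is then missing is
    the Polyak-Lojasiewicz inequality 2 mu (f_k - f_* ) <= |g_k|^2.  A single
    interpolation constraint, the one for the pair ( *, k), already contains it: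
      |g_k|^2 - 2 mu (f_k - f_* )
        = 2 mu h_( *,k) + L / (L - mu) |g_k - mu (x_k - x_* )|^2
    as polynomials.  Multiplying by a and adding the Wolfe constraint gives the
    certificate, with multipliers 2 mu a and 1 on these two constraints and 0 on
    the others ([contraction_identity], [contraction_certificate]).

    The bound on the function values follows by evaluating the certificate at
    the iterates ([sos_certificate_sound]), once the constraints are known to
    hold there.

    For the interpolation constraints ([mu_L_smooth_interp]) a single point w is
    used: the strong convexity bound based at q and the descent bound based at p
    enclose f (p - w) between two quadratics, and comparing them at the w that
    makes the gap smallest leaves exactly the interpolation inequality.  The
    descent bound integrates the Lipschitz condition along a line; the strong
    convexity bound is the first-order condition of a convex function, again on
    a line.  The minimizer enters through its zero gradient.

    For the Wolfe constraint ([wolfe_sufficient_decrease]) the curvature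
    condition forces the gradient to change by a fixed proportion along the
    step, and since it is L-Lipschitz the step size cannot be smaller than
    (1 - c2) / L unless the gradient vanishes; sufficient decrease then turns
    this step size into a decrease of f. *)

(** * The Euclidean inner product *)

Section DotTheory.
Variables (A : comNzRingType) (n : nat).
Implicit Types (u v w : 'rV[A]_n) (a : A).

Lemma dotE u v : dot u v = \sum_j u 0 j * v 0 j.
Proof. by rewrite /dot mxE; apply: eq_bigr => j _; rewrite mxE. Qed.

Lemma dotC u v : dot u v = dot v u.
Proof. by rewrite !dotE; apply: eq_bigr => j _; rewrite mulrC. Qed.

Lemma dotDl u v w : dot (u + v) w = dot u w + dot v w.
Proof. by rewrite /dot mulmxDl mxE. Qed.

Lemma dotNl u v : dot (- u) v = - dot u v.
Proof. by rewrite /dot mulNmx mxE. Qed.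

Lemma dotZl a u v : dot (a *: u) v = a * dot u v.
Proof. by rewrite /dot -scalemxAl mxE. Qed.

Lemma dotDr u v w : dot u (v + w) = dot u v + dot u w.
Proof. by rewrite !(dotC u) dotDl. Qed.

Lemma dotNr u v : dot u (- v) = - dot u v.
Proof. by rewrite !(dotC u) dotNl. Qed.

Lemma dotZr a u v : dot u (a *: v) = a * dot u v.
Proof. by rewrite !(dotC u) dotZl. Qed.

Definition dot_bilinear := (dotDl, dotDr, dotNl, dotNr, dotZl, dotZr).

End DotTheory.

Section EuclideanNorm.
Variables (R : realType) (n : nat).
Implicit Types u v : 'rV[R]_n.

Lemma dot_ge0 u : 0 <= dot u u.
Proof. by rewrite dotE; apply: sumr_ge0 => j _; rewrite -expr2 sqr_ge0. Qed.

Lemma dot_eq0 u : dot u u = 0 -> u = 0.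
Proof.
rewrite dotE => /psumr_eq0P u0; apply/rowP => j; rewrite mxE; apply/eqP.
rewrite -sqrf_eq0 expr2; apply/eqP/u0 => // i _.
by rewrite -expr2 sqr_ge0.
Qed.

Lemma enorm_ge0 u : 0 <= enorm u.
Proof. exact: sqrtr_ge0. Qed.

Lemma sqr_enorm u : enorm u ^+ 2 = dot u u.
Proof. by rewrite /enorm sqr_sqrtr// dot_ge0. Qed.

Lemma enormZ a u : 0 <= a -> enorm (a *: u) = a * enorm u.
Proof.
move=> a0; rewrite /enorm !dot_bilinear mulrA -expr2 sqrtrM ?sqr_ge0//.
by rewrite sqrtr_sqr ger0_norm.
Qed.

Lemma CauchySchwarz_dot u v : dot u v <= enorm u * enorm v.
Proof.
have [|uv0] := eqVneq (enorm u * enorm v) 0.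
  move/eqP; rewrite mulf_eq0 => /orP[] /eqP w0.
    have -> : u = 0 by apply: dot_eq0; rewrite -sqr_enorm w0 expr0n.
    by rewrite /dot mul0mx mxE mulr_ge0// enorm_ge0.
  have -> : v = 0 by apply: dot_eq0; rewrite -sqr_enorm w0 expr0n.
  by rewrite /dot trmx0 mulmx0 mxE mulr_ge0// enorm_ge0.
(* Nonnegativity of | |v| u - |u| v |^2, divided by 2 |u| |v|. *)
have uv_gt0 : 0 < enorm u * enorm v by rewrite lt0r uv0 mulr_ge0 ?enorm_ge0.
rewrite -(ler_pM2l uv_gt0) -subr_ge0.
have := dot_ge0 (enorm v *: u - enorm u *: v).
rewrite !dot_bilinear (dotC v u) -!sqr_enorm => h; nra.
Qed.

End EuclideanNorm.

(** * Restriction of a differentiable function to a line *)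

Section Line.
Variables (R : realType) (n : nat) (f : 'rV[R]_n -> R).
Hypothesis df : forall p, differentiable f p.

Lemma diff_grad p d : 'd f p d = dot (grad f p) d.
Proof.
rewrite {1}(row_sum_delta d) linear_sum dotE; apply: eq_bigr => j _.
by rewrite linearZ /= -deriveE// mxE mulrC.
Qed.

Lemma is_derive_line p d (t : R) :
  is_derive t 1 (fun s : R => f (p + s *: d)) (dot (grad f (p + t *: d)) d).
Proof.
have dline : is_diff t (fun s : R => p + s *: d) (0 + ( *:%R ^~ d)).
  exact: is_diffD.
have dfl := differentiableP (df (p + t *: d)).
have comp := is_diff_comp dline dfl.
apply: DeriveDef; first exact/diff_derivable/ex_diff.
rewrite deriveE; last exact: ex_diff.
by rewrite diff_val /= add0r scale1r diff_grad.
Qed.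

End Line.

(** * Smoothness and strong convexity as quadratic bounds *)

(** The gradient at p + t d exceeds the one at p by at most L t |d|, so that
    along the line f minus the claimed upper bound is nonincreasing. *)
Lemma descent (R : realType) (n : nat) (L : R) (f : 'rV[R]_n -> R) :
  (forall p, differentiable f p) ->
  (forall p q, enorm (grad f p - grad f q) <= L * enorm (p - q)) ->
  forall p d, f (p + d) <= f p + dot (grad f p) d + L / 2%:R * dot d d.
Proof.
move=> df lipf p d.
pose phi (t : R) :=
  f (p + t *: d) - t * dot (grad f p) d - t ^+ 2 * (L / 2%:R * dot d d).
pose dphi (t : R) := dot (grad f (p + t *: d) - grad f p) d - L * t * dot d d.
have dphiP (t : R) : is_derive t 1 phi (dphi t).
  have dl := is_derive_line df p d t.
  have -> : phi = (fun s : R => f (p + s *: d)) - dot (grad f p) d *: id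
                  - (L / 2%:R * dot d d) *: (id ^+ 2).
    by apply/funext => s; rewrite /phi !fctE; congr (_ - _ - _); exact: mulrC.
  apply: is_derive_eq; rewrite /dphi !dot_bilinear /GRing.scale /=.
  by field.
have dphi_le0 (t : R) : t \in `]0, 1[ -> phi^`()%classic t <= 0.
  rewrite in_itv /= => /andP[/ltW t0 _]; rewrite derive1E derive_val subr_le0.
  apply: le_trans (CauchySchwarz_dot _ _) _.
  have := lipf (p + t *: d) p; rewrite addrAC subrr add0r enormZ// => le_grad.
  rewrite -sqr_enorm expr2 mulrA -(mulrA L).
  exact: ler_wpM2r (enorm_ge0 _) _ _ le_grad.
have phi_cont : {within `[0, 1], continuous phi}%classic.
  by apply: derivable_within_continuous => t _; exact: ex_derive.
have : phi 1 <= phi 0.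
  by apply: (ler0_derive1_le_cc _ dphi_le0 phi_cont);
    rewrite ?in_itv /= ?lexx ?ler01.
rewrite /phi scale0r scale1r addr0; lra.
Qed.

Lemma derive_le0_right_max (R : realType) (phi : R -> R) (l : R) :
  is_derive (0 : R) (1 : R) phi l ->
  (forall t, 0 < t -> t < 1 -> phi t <= phi 0) -> l <= 0.
Proof.
move=> [dphi <-] phi_max.
apply: (cvgr_to_le (cvg_dnbhs_at_right dphi)).
near=> h; rewrite /= addr0 [h%:A]mulr1.
have h0 : 0 < h by near: h; exact: nbhs_right_gt.
rewrite /GRing.scale /= pmulr_rle0 ?invr_gt0// subr_le0 phi_max//.
Unshelve. all: by end_near. Qed.

(** Along the segment from p to p + d, f lies below its chord by at least
    mu / 2 t (1 - t) |d|^2.  Both sides agree at t = 0, so their derivatives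
    there compare, and this comparison is the claim. *)
Lemma strongly_convex_above_quadratic (R : realType) (n : nat) (mu : R)
    (f : 'rV[R]_n -> R) :
  (forall p, differentiable f p) ->
  convex_on_space (fun p => f p - mu / 2%:R * enorm p ^+ 2) ->
  forall p d, f p + dot (grad f p) d + mu / 2%:R * dot d d <= f (p + d).
Proof.
move=> df cvxf p d.
(* phi is f on the segment minus (its lowered chord minus f p). *)
pose c := f (p + d) - f p - mu / 2%:R * dot d d.
pose phi (t : R) := f (p + t *: d) - t * c - t ^+ 2 * (mu / 2%:R * dot d d).
have dphi : is_derive (0 : R) (1 : R) phi (dot (grad f p) d - c).
  have dl := is_derive_line df p d 0.
  have -> : phi = (fun s : R => f (p + s *: d)) - c *: id
                  - (mu / 2%:R * dot d d) *: (id ^+ 2).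
    by apply/funext => s; rewrite /phi !fctE; congr (_ - _ - _); exact: mulrC.
  apply: is_derive_eq; rewrite scale0r addr0 /GRing.scale /=.
  by field.
have : dot (grad f p) d - c <= 0.
  apply: (derive_le0_right_max dphi) => t t0 t1.
  have := cvxf (Itv01 (ltW t0) (ltW t1)) (p + d) p (mem_setT _) (mem_setT _).
  rewrite !sqr_enorm !convRE /=.
  have -> : conv (Itv01 (ltW t0) (ltW t1)) (p + d : convex_lmodType 'rV[R]_n) p
            = p + t *: d.
    by rewrite /conv /= scalerDr scalerBl scale1r addrAC subrKC.
  rewrite /phi /c /unstable.onem !dot_bilinear (dotC d p) scale0r addr0 => h.
  lra.
rewrite /c; lra.
Qed.

Section Interpolation.
Variables (R : realType) (n : nat) (mu L : R) (f : 'rV[R]_n -> R).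
Hypothesis hf : mu_L_smooth mu L f.
Hypothesis muL : mu < L.

(** Put d = p - q and let e be the difference of the gradients.  For every w,
    strong convexity at q and descent at p bound f (p - w) from below and from
    above; the resulting lower bound for f p - f q is a concave quadratic in w,
    maximal at w = (e - mu d) / (L - mu), where it equals the claimed one. *)
Lemma mu_L_smooth_interp p q :
  0 < L ->
  0 <= f p - f q - dot (grad f q) (p - q)
       - L / (2%:R * (L - mu)) *
         (L^-1 * dot (grad f p - grad f q) (grad f p - grad f q)
          + mu * dot (p - q) (p - q)
          - 2%:R * (mu / L) * dot (grad f q - grad f p) (q - p)).
Proof.
move=> L0; have [_ df lipf scf] := hf.
have L_neq0 : L != 0 by rewrite gt_eqF.
have Lmu_neq0 : L - mu != 0 by rewrite subr_eq0 gt_eqF.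
pose d := p - q; pose e := grad f p - grad f q.
pose w := (L - mu)^-1 *: (e - mu *: d).
have up := descent df lipf p (- w).
have := strongly_convex_above_quadratic df scf q (d - w).
have -> : q + (d - w) = p - w by rewrite addrA subrKC.
move=> /le_trans/(_ up); rewrite -subr_ge0.
rewrite -[q - p]opprB -[grad f q - grad f p]opprB -/d -/e.
have -> : grad f p = e + grad f q by rewrite subrK.
clearbody d e; rewrite /w !dot_bilinear (dotC d e).
congr (0 <= _); field.
by rewrite L_neq0.
Qed.

(** A gradient step of size 1 / L from a point decreases f by at least
    |g|^2 / (2 L), which is impossible at a minimizer unless g = 0. *)
Lemma grad_eq0_min xs : 0 < L -> (forall y, f xs <= f y) -> grad f xs = 0.
Proof.
move=> L0 min_xs; have [_ df lipf _] := hf.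
set g := grad f xs.
have := le_trans (min_xs _) (descent df lipf xs (- L^-1 *: g)).
rewrite -/g !dot_bilinear => h; apply: dot_eq0; apply: le_anti.
have invL : 0 < (2%:R * L)^-1 by rewrite invr_gt0 mulr_gt0.
rewrite dot_ge0 andbT -(pmulr_rle0 _ invL).
have gain : - L^-1 * dot g g + L / 2%:R * (- L^-1 * (- L^-1 * dot g g))
            = - ((2%:R * L)^-1 * dot g g) by field; rewrite gt_eqF.
lra.
Qed.

End Interpolation.

(** The curvature condition, Cauchy-Schwarz and the Lipschitz bound give
    (1 - c2) |g|^2 <= <g_p - g_q, g_p> <= L gamma |g|^2.  Keeping the factor
    |g|^2, instead of deducing gamma >= (1 - c2) / L, covers g = 0 too. *)
Lemma wolfe_sufficient_decrease (R : realType) (n : nat) (L c1 c2 gamma : R)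
    (f : 'rV[R]_n -> R) (p q : 'rV[R]_n) :
  0 < L -> 0 <= c1 -> 0 < gamma ->
  enorm (grad f p - grad f q) <= L * enorm (p - q) ->
  q = p - gamma *: grad f p ->
  f q <= f p - c1 * gamma * enorm (grad f p) ^+ 2 ->
  dot (grad f q) (grad f p) <= c2 * enorm (grad f p) ^+ 2 ->
  0 <= f p - f q - c1 * (1 - c2) / L * dot (grad f p) (grad f p).
Proof.
move=> L0 c1_ge0 gamma0 lipf qE; rewrite sqr_enorm => decr curv.
have stepE : p - q = gamma *: grad f p by rewrite qE opprB addrC subrK.
have := CauchySchwarz_dot (grad f p - grad f q) (grad f p).
move: lipf; rewrite stepE (enormZ _ (ltW gamma0)) => lipf.
move=> /le_trans/(_ (ler_wpM2r (enorm_ge0 _) lipf)).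
rewrite !dot_bilinear => step.
set G := dot (grad f p) (grad f p) in decr curv step *.
have {}step : (1 - c2) * G <= L * (gamma * G).
  by move: step; rewrite -!mulrA -expr2 sqr_enorm -/G; lra.
have : c1 * (1 - c2) / L * G <= c1 * gamma * G.
  rewrite mulrAC ler_pdivrMr// -!mulrA ler_wpM2l//.
  by apply: le_trans step _; rewrite le_eqVlt; apply/orP; left; apply/eqP; ring.
lra.
Qed.

(** * The certificate *)

(** A nonnegative multiple of a squared length: the squares are those of the
    coordinates, rescaled by the square root of the multiplier. *)
Lemma is_sos_dot (R : realType) (N d n : nat) (c : R) (v : 'rV[mpoly N R]_n) :
  0 <= c -> (forall j, msize (v 0%R j) <= d.+1)%N -> is_sos d (c *: dot v v).
Proof.
move=> c0 size_v; exists [seq Num.sqrt c *: v 0 j | j <- enum 'I_n]; split.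
  apply/allP => _ /mapP[j _ ->].
  exact: leq_trans (msizeZ_le _ _) (size_v j).
rewrite big_map big_enum dotE scaler_sumr; apply: eq_bigr => j _ /=.
by rewrite exprZn sqr_sqrtr.
Qed.

Lemma is_sos_meval_ge0 (R : realType) (N d : nat) (p : mpoly N R)
  (z : 'I_N -> R) : is_sos d p -> 0 <= meval z p.
Proof.
move=> [s [_ ->]]; rewrite raddf_sum; apply: sumr_ge0 => q _.
by rewrite /= expr2 mevalM -expr2 sqr_ge0.
Qed.

Lemma sos_certificate_sound (R : realType) (N d m : nat)
    (h : m.-tuple (mpoly N R)) (p : mpoly N R) (z : 'I_N -> R) :
  sos_certificate d h p -> (forall i, 0 <= meval z (tnth h i)) ->
  0 <= meval z p.
Proof.
move=> [sigma0 [sigma [sos0 sigma_ge0 ->]]] h_ge0.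
rewrite mevalD addr_ge0 ?(is_sos_meval_ge0 _ sos0)// raddf_sum.
by apply: sumr_ge0 => i _ /=; rewrite mevalZ mulr_ge0.
Qed.

(** The polynomial identity behind the certificate, with g = g_k and
    d = x_k - x_*.  Here r and b stand for 1 / L and L / (2 (L - mu)); the
    relation between them makes the coefficients of |g|^2 and <g, d> cancel.
    C embeds the scalars in the polynomial ring. *)
Lemma contraction_identity (K A : comNzRingType) (C : {rmorphism K -> A})
    (n : nat) (mu a b r : K) (fs fk fn : A) (g d : 'rV[A]_n) :
  2%:R * b * (1 - mu * r) = 1 ->
  C (1 - 2%:R * mu * a) * (fk - fs) - (fn - fs)
  = C (2%:R * a * b) * dot (g - C mu *: d) (g - C mu *: d)
    + (C (2%:R * mu * a) *
         (fs - fk - dot g (- d)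
          - C b * (C r * dot (- g) (- g) + C mu * dot (- d) (- d)
                   - C (2%:R * (mu * r)) * dot g d))
       + (fk - fn - C a * dot g g)).
Proof.
move=> /(congr1 C) br; rewrite !dot_bilinear (dotC d g).
rewrite rmorph1 in br.
apply/eqP; rewrite -subr_eq0; apply/eqP.
transitivity ((1 - C (2%:R * b * (1 - mu * r)))
              * (C a * (dot g g - C (2%:R * mu) * dot g d))); first by ring.
by rewrite br subrr mul0r.
Qed.

Lemma contraction_certificate (R : realType) (n : nat) (mu L c1 c2 : R) :
  0 <= mu -> mu < L -> 0 <= c1 -> c2 <= 1 ->
  sos_certificate 1 (constraints n mu L c1 c2)
    (bound_poly n (1 - 2%:R * mu * c1 * (1 - c2) / L)).
Proof.
move=> mu0 muL c1_ge0 c2_le1.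
have L0 : 0 < L by exact: le_lt_trans muL.
have Lmu0 : 0 < L - mu by rewrite subr_gt0.
pose a := c1 * (1 - c2) / L.
have a0 : 0 <= a by rewrite /a divr_ge0 ?mulr_ge0 ?subr_ge0// ltW.
pose b := L / (2%:R * (L - mu)).
have b0 : 0 <= b.
  by apply: divr_ge0; [exact: ltW | apply: mulr_ge0 => //; exact: ltW].
pose g : 'rV[zpoly R n]_n := gvar R n Cur.
pose d : 'rV[zpoly R n]_n := xvar R n Cur - xvar R n Star.
pose muP := mpolyC (3 + 5 * n) mu.
(* The positions of the two constraints with a nonzero multiplier. *)
pose ipl := @Ordinal 7 4 isT; pose iwolfe := @Ordinal 7 6 isT.
have hpl : tnth (constraints n mu L c1 c2) ipl = h_interp n mu L Star Cur.
  by [].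
have hwolfe : tnth (constraints n mu L c1 c2) iwolfe = h_wolfe n L c1 c2.
  by [].
(* With the tuple abstract, simplification cannot unfold its polynomials. *)
move: (constraints n mu L c1 c2) hpl hwolfe => h hpl hwolfe.
exists ((2%:R * a * b) *: dot (g - muP *: d) (g - muP *: d)).
exists (fun i => if i == ipl then 2%:R * mu * a else (i == iwolfe)%:R).
split.
- apply: is_sos_dot => [|j].
    by apply: mulr_ge0 => //; exact: mulr_ge0.
  rewrite /g /d /muP !mxE mul_mpolyC.
  apply: leq_trans (msizeD_le _ _) _; rewrite geq_max msizeX mdeg1 msizeN /=.
  apply: leq_trans (msizeZ_le _ _) _.
  apply: leq_trans (msizeD_le _ _) _.
  by rewrite geq_max msizeN !msizeX !mdeg1.
- move=> i; case: ifP => _; last exact: ler0n.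
  by apply: mulr_ge0 => //; exact: mulr_ge0.
have -> :
    \sum_i (if i == ipl then 2%:R * mu * a else (i == iwolfe)%:R) *: tnth h i
    = (2%:R * mu * a) *: h_interp n mu L Star Cur + h_wolfe n L c1 c2.
  rewrite (bigD1 ipl)//= (bigD1 iwolfe)//= big1; last first.
    by move=> i /andP[/negbTE -> /negbTE ->]; rewrite scale0r.
  by rewrite addr0 scale1r hpl hwolfe.
rewrite /bound_poly /h_interp /h_wolfe.
rewrite (_ : gvar R n Star = 0)// sub0r subr0 -(opprB (xvar R n Cur)) -/g -/d.
rewrite -!mul_mpolyC.
have -> : 1 - 2%:R * mu * c1 * (1 - c2) / L = 1 - 2%:R * mu * a.
  by rewrite /a; ring.
pose C : {rmorphism R -> zpoly R n} := @mpolyC (3 + 5 * n) R.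
apply: (contraction_identity C).
by rewrite /b; field; rewrite !gt_eqF.
Qed.

(** * Values of the constraints at the iterates *)

Lemma meval_dot (R : realType) (N n : nat) (z : 'I_N -> R)
    (u v : 'rV[mpoly N R]_n) :
  meval z (dot u v) = dot (map_mx (meval z) u) (map_mx (meval z) v).
Proof.
rewrite !dotE raddf_sum; apply: eq_bigr => j _.
by rewrite /= mevalM !mxE.
Qed.

Section Evaluation.
Variables (R : realType) (n : nat).
Variables (fs fk fk1 : R) (xs xk xk1 gk gk1 : 'rV[R]_n).

Let z := zpoint fs fk fk1 xs xk xk1 gk gk1.

Definition fval (i : pt) : R :=
  match i with Star => fs | Cur => fk | Next => fk1 end.

Definition xval (i : pt) : 'rV[R]_n :=
  match i with Star => xs | Cur => xk | Next => xk1 end.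

Definition gval (i : pt) : 'rV[R]_n :=
  match i with Star => 0 | Cur => gk | Next => gk1 end.

Lemma meval_fvar i : meval z (fvar R n i) = fval i.
Proof. by case: i; rewrite mevalXU /z /zpoint row_mxEl mxE. Qed.

Lemma meval_vector_var b :
  map_mx (meval z) (vector_var R n b) = [:: xs; xk; xk1; gk; gk1]`_b.
Proof.
by apply/rowP => j; rewrite !mxE mevalXU /z /zpoint row_mxEr mxvecE mxE.
Qed.

Lemma meval_xvar i : map_mx (meval z) (xvar R n i) = xval i.
Proof. by case: i; rewrite meval_vector_var. Qed.

Lemma meval_gvar i : map_mx (meval z) (gvar R n i) = gval i.
Proof. by case: i; rewrite /= ?meval_vector_var ?map_mx0. Qed.

Definition meval_var := (meval_fvar, meval_xvar, meval_gvar).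

Lemma meval_h_interp (mu L : R) i j :
  meval z (h_interp n mu L i j)
  = fval i - fval j - dot (gval j) (xval i - xval j)
    - L / (2%:R * (L - mu)) *
      (L^-1 * dot (gval i - gval j) (gval i - gval j)
       + mu * dot (xval i - xval j) (xval i - xval j)
       - 2%:R * (mu / L) * dot (gval j - gval i) (xval j - xval i)).
Proof.
rewrite /h_interp -!meval_fvar -!meval_xvar -!meval_gvar -!map_mxB -!meval_dot.
(* Both sides are now the same combination of evaluations of six polynomials,
   whose own structure must stay hidden from the linearity lemmas. *)
move: (fvar R n i) (fvar R n j) (dot (gvar R n j) _) (dot (gvar R n i - _) _)
  (dot (xvar R n i - _) _) (dot (gvar R n j - _) _) => fi fj p1 p2 p3 p4.
by rewrite !(mevalD, mevalN, mevalZ).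
Qed.

Lemma meval_h_wolfe (L c1 c2 : R) :
  meval z (h_wolfe n L c1 c2) = fk - fk1 - c1 * (1 - c2) / L * dot gk gk.
Proof.
rewrite /h_wolfe -[fk]/(fval Cur) -[fk1]/(fval Next) -[gk]/(gval Cur).
rewrite -!meval_fvar -!meval_gvar -meval_dot.
move: (fvar R n Cur) (fvar R n Next) (dot _ _) => p1 p2 p3.
by rewrite !(mevalD, mevalN, mevalZ).
Qed.

Lemma meval_bound_poly (t : R) :
  meval z (bound_poly n t) = t * (fk - fs) - (fk1 - fs).
Proof. by rewrite /bound_poly !(mevalD, mevalN, mevalZ) !meval_var. Qed.

End Evaluation.

Theorem theorem6 (R : realType) (n : nat) (mu L c1 c2 : R)
    (hmu : 0 <= mu) (hmuL : mu < L)
    (hc1 : 0 < c1) (hc12 : c1 < c2) (hc2 : c2 < 1)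
    (f : 'rV[R]_n -> R) (hf : mu_L_smooth mu L f)
    (xs : 'rV[R]_n) (hxs : forall y, f xs <= f y)
    (x : nat -> 'rV[R]_n) (gamma : nat -> R)
    (hx : gd_wolfe c1 c2 f x gamma)
    (k : nat) (hk : (1 <= k)%N) :
  let t := 1 - 2%:R * mu * c1 * (1 - c2) / L in
  let z := zpoint (f xs) (f (x k)) (f (x k.+1)) xs (x k) (x k.+1)
             (grad f (x k)) (grad f (x k.+1)) in
  let h := constraints n mu L c1 c2 in
  [/\ f (x k.+1) - f xs <= t * (f (x k) - f xs),
      forall i : 'I_7, 0 <= mpoly.meval z (tnth h i) &
      sos_certificate 1 h (bound_poly n t)].
Proof.
move=> t z h.
have L0 : 0 < L by exact: le_lt_trans hmuL.
have cert : sos_certificate 1 h (bound_poly n t).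
  by apply: contraction_certificate => //; exact: ltW.
have interp i j : 0 <= meval z (h_interp n mu L i j).
  have gs := grad_eq0_min hf L0 hxs.
  rewrite meval_h_interp.
  by have := mu_L_smooth_interp hf hmuL (xval xs (x k) (x k.+1) i)
    (xval xs (x k) (x k.+1) j) L0; case: i; case: j; rewrite /= ?gs.
have wolfe : 0 <= meval z (h_wolfe n L c1 c2).
  have [gamma0 stepE decr curv] := hx k hk; have [_ _ lipf _] := hf.
  rewrite meval_h_wolfe.
  apply: (wolfe_sufficient_decrease L0 (ltW hc1) gamma0 (lipf _ _)) => //.
  by rewrite stepE.
have h_ge0 i : 0 <= meval z (tnth h i).
  case: i => [[|[|[|[|[|[|[|//]]]]]]] lti].
  - exact: (interp Cur Next).
  - exact: (interp Cur Star).
  - exact: (interp Next Cur).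
  - exact: (interp Next Star).
  - exact: (interp Star Cur).
  - exact: (interp Star Next).
  - exact: wolfe.
split=> //.
by have := sos_certificate_sound cert h_ge0; rewrite meval_bound_poly subr_ge0.
Qed.
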